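(* For every non-deterministic $\lambda$-term $M$, if $M$ is strongly normalizable, then there exist a context $\Gamma$ and a type $A$ such that $\Gamma\vdash M:A$ is derivable in the type system $\mathcal D_+$.
   Context: Non-deterministic $\lambda$-terms are given by $M::=x\mid\lambda x.M\mid (M)N\mid M+N$, taken up to $\alpha$-equivalence and the identities $M+N=N+M$, $(M+N)+P=M+(N+P)$, $\lambda x.(M+N)=\lambda x.M+\lambda x.N$, $(M+N)P=(M)P+(N)P$. $\beta$-reduction is the contextual closure of $(\lambda x.M)N\to_\beta M[N/x]$. The term $M$ is strongly normalizable if it has no infinite $\beta$-reduction sequence. System $\mathcal D_+$. Types are $A,B::=X\mid A\to B\mid A\cap B$, where $X$ ranges over propositional variables. The subtyping relation $\le$ is the least reflexive and transitive relation closed under the rules: - $A_1\cap A_2\le A_i$ for $i=1,2$; - if $A'\le A$ and $B\le B'$ then $A\to B\le A'\to B'$; - $(A\to B)\cap(A\to C)\le A\to(B\cap C)$. Contexts $\Gamma$ assign types to finitely many variables. The typing rules are: - (var) $\Gamma,x:A\vdash x:A$; - (abs) from $\Gamma,x:A\vdash M:B$ infer $\Gamma\vdash\lambda x.M:A\to B$; - (app) from $\Gamma\vdash M:A\to B$ and $\Gamma\vdash N:A$ infer $\Gamma\vdash(M)N:B$; - (int) from $\Gamma\vdash M:A$ and $\Gamma\vdash M:B$ infer $\Gamma\vdash M:A\cap B$; - (plus) from $\Gamma\vdash M:A$ and $\Gamma\vdash N:A$ infer $\Gamma\vdash M+N:A$; - (sub) from $\Gamma\vdash M:A$ and $A\le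 A'$ infer $\Gamma\vdash M:A'$. *)

(* Defs.v *)
From Stdlib Require Import List.

(** Raw terms.  Names are de Bruijn indices, so syntactic equality is already
    alpha-equivalence; the identities on sums are imposed by [term_eq]. *)
Inductive term : Type :=
| Var (n : nat)
| Lam (M : term)
| App (M N : term)
| Plus (M N : term).

Definition up_ren (r : nat -> nat) (n : nat) : nat :=
  match n with
  | 0 => 0
  | S k => S (r k)
  end.

Fixpoint rename (r : nat -> nat) (M : term) : term :=
  match M with
  | Var n => Var (r n)
  | Lam M1 => Lam (rename (up_ren r) M1)
  | App M1 M2 => App (rename r M1) (rename r M2)
  | Plus M1 M2 => Plus (rename r M1) (rename r M2)
  end.

Definition up_subst (s : nat -> term) (n : nat) : term :=
  match n with
  | 0 => Var 0
  | S k => rename S (s k)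
  end.

Fixpoint subst (s : nat -> term) (M : term) : term :=
  match M with
  | Var n => s n
  | Lam M1 => Lam (subst (up_subst s) M1)
  | App M1 M2 => App (subst s M1) (subst s M2)
  | Plus M1 M2 => Plus (subst s M1) (subst s M2)
  end.

(** [M[N/x]], where [x] is the variable of index [0] in [M]; the other indices
    are lowered by one because the binder of [x] disappears. *)
Definition subst1 (N M : term) : term :=
  subst (fun n => match n with 0 => N | S k => Var k end) M.

(** The congruence generated by the four identities.  Non-deterministic terms
    are the raw terms modulo [term_eq]. *)
Inductive term_eq : term -> term -> Prop :=
| teq_plus_comm M N : term_eq (Plus M N) (Plus N M)
| teq_plus_assoc M N P :
    term_eq (Plus (Plus M N) P) (Plus M (Plus N P))
| teq_lam_plus M N :
    term_eq (Lam (Plus M N)) (Plus (Lam M) (Lam N))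
| teq_app_plus M N P :
    term_eq (App (Plus M N) P) (Plus (App M P) (App N P))
| teq_refl M : term_eq M M
| teq_sym M N : term_eq M N -> term_eq N M
| teq_trans M N P : term_eq M N -> term_eq N P -> term_eq M P
| teq_lam M M' : term_eq M M' -> term_eq (Lam M) (Lam M')
| teq_app M M' N N' :
    term_eq M M' -> term_eq N N' -> term_eq (App M N) (App M' N')
| teq_plus M M' N N' :
    term_eq M M' -> term_eq N N' -> term_eq (Plus M N) (Plus M' N').

Inductive beta_raw : term -> term -> Prop :=
| beta_redex M N : beta_raw (App (Lam M) N) (subst1 N M)
| beta_lam M M' : beta_raw M M' -> beta_raw (Lam M) (Lam M')
| beta_app_l M M' N : beta_raw M M' -> beta_raw (App M N) (App M' N)
| beta_app_r M N N' : beta_raw N N' -> beta_raw (App M N) (App M N')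
| beta_plus_l M M' N : beta_raw M M' -> beta_raw (Plus M N) (Plus M' N)
| beta_plus_r M N N' : beta_raw N N' -> beta_raw (Plus M N) (Plus M N').

(** One step between classes modulo [term_eq]: some representatives reduce.
    Since [term_eq] is a congruence, this is the contextual closure of the
    beta rule on classes. *)
Definition beta (M N : term) : Prop :=
  exists M' N', term_eq M M' /\ beta_raw M' N' /\ term_eq N' N.

Definition strongly_normalizable (M : term) : Prop :=
  ~ exists f : nat -> term, f 0 = M /\ forall n, beta (f n) (f (S n)).

(** Propositional variables are indexed by [nat]. *)
Inductive type : Type :=
| TVar (X : nat)
| Arrow (A B : type)
| Inter (A B : type).

Inductive subtype : type -> type -> Prop :=
| st_refl A : subtype A A
| st_trans A B C : subtype A B -> subtype B C -> subtype A C
| st_inter_l A1 A2 : subtype (Inter A1 A2) A1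
| st_inter_r A1 A2 : subtype (Inter A1 A2) A2
| st_arrow A A' B B' :
    subtype A' A -> subtype B B' -> subtype (Arrow A B) (Arrow A' B')
| st_arrow_inter A B C :
    subtype (Inter (Arrow A B) (Arrow A C)) (Arrow A (Inter B C)).

(** Position [n] of the list is the type of the free variable of index [n]. *)
Definition context : Type := list type.

(** [ty_eq] makes the judgement one about classes modulo [term_eq]: every
    other rule may be applied to any representative of the term. *)
Inductive typing : context -> term -> type -> Prop :=
| ty_var Gamma n A :
    nth_error Gamma n = Some A -> typing Gamma (Var n) A
| ty_abs Gamma M A B :
    typing (A :: Gamma) M B -> typing Gamma (Lam M) (Arrow A B)
| ty_app Gamma M N A B :
    typing Gamma M (Arrow A B) -> typing Gamma N A -> typing Gamma (App M N) B
| ty_int Gamma M A B :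
    typing Gamma M A -> typing Gamma M B -> typing Gamma M (Inter A B)
| ty_plus Gamma M N A :
    typing Gamma M A -> typing Gamma N A -> typing Gamma (Plus M N) A
| ty_sub Gamma M A A' :
    typing Gamma M A -> subtype A A' -> typing Gamma M A'
| ty_eq Gamma M N A :
    typing Gamma M A -> term_eq M N -> typing Gamma N A.

(* Main.v *)
(** By induction on a strongly normalizable term [M], refined by size, through
    its spine form [H P1 ... Pk]: a sum in head position distributes over the
    spine up to [term_eq], and a head redex is treated by subject expansion.
    Since the two summands of a sum need a common type, the induction proves
    that [M] has a type [T1 -> ... -> Tn -> X] for all large [n]: two types of
    this shape with the same [n] have a common supertype of the same shape,
    obtained by intersecting the [Ti] in contravariant position. *)

From Stdlib Require Import List Arith Lia Classical ClassicalEpsilon.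
Require Import Defs.
Import ListNotations.

(** * Typing with total contexts *)

Definition scons (A : type) (Gamma : nat -> type) (n : nat) : type :=
  match n with
  | 0 => A
  | S k => Gamma k
  end.

(** Typing with total contexts, so that every variable has a type and contexts
    can be intersected pointwise, and without [ty_eq], so that it can be
    inverted. *)
Inductive has_type : (nat -> type) -> term -> type -> Prop :=
| ht_var Gamma n : has_type Gamma (Var n) (Gamma n)
| ht_abs Gamma M A B :
    has_type (scons A Gamma) M B -> has_type Gamma (Lam M) (Arrow A B)
| ht_app Gamma M N A B :
    has_type Gamma M (Arrow A B) -> has_type Gamma N A ->
    has_type Gamma (App M N) B
| ht_int Gamma M A B :
    has_type Gamma M A -> has_type Gamma M B -> has_type Gamma M (Inter A B)
| ht_plus Gamma M N A :
    has_type Gamma M A -> has_type Gamma N A -> has_type Gamma (Plus M N) A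
| ht_sub Gamma M A A' :
    has_type Gamma M A -> subtype A A' -> has_type Gamma M A'.

(** A derivation looks up finitely many variables, and [k] bounds their indices. Asking only for
    agreement below [k] lets the bounds of two premises be added. *)
Lemma has_type_typing Gamma M A :
  has_type Gamma M A ->
  exists k, forall l,
    (forall n, n < k -> nth_error l n = Some (Gamma n)) -> typing l M A.
Proof.
  induction 1 as [Gamma n|Gamma M A B _ [k IH]|Gamma M N A B _ [k1 IH1] _ [k2 IH2]
    |Gamma M A B _ [k1 IH1] _ [k2 IH2]|Gamma M N A _ [k1 IH1] _ [k2 IH2]
    |Gamma M A A' _ [k IH] Hs].
  - exists (S n). intros l Hl. apply ty_var, Hl. lia.
  - exists k. intros l Hl. apply ty_abs, IH.
    intros [|n] Hn; [reflexivity|]. apply Hl. lia.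
  - exists (k1 + k2). intros l Hl.
    apply ty_app with A; [apply IH1|apply IH2]; intros; apply Hl; lia.
  - exists (k1 + k2). intros l Hl.
    apply ty_int; [apply IH1|apply IH2]; intros; apply Hl; lia.
  - exists (k1 + k2). intros l Hl.
    apply ty_plus; [apply IH1|apply IH2]; intros; apply Hl; lia.
  - exists k. intros l Hl. apply ty_sub with A; auto.
Qed.

Lemma has_type_rename Gamma M A :
  has_type Gamma M A ->
  forall r Delta, (forall n, Delta (r n) = Gamma n) ->
  has_type Delta (rename r M) A.
Proof.
  induction 1; intros r Delta HD; simpl; eauto using has_type.
  - rewrite <- HD. apply ht_var.
  - apply ht_abs, IHhas_type. intros [|n]; [reflexivity|apply HD].
Qed.

(** Strengthening, used to leave a binder: a type found for [rename S (s n)] is brought back to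
    [s n]. *)
Lemma has_type_rename_inv Delta P A :
  has_type Delta P A ->
  forall r M Gamma, P = rename r M -> (forall n, Delta (r n) = Gamma n) ->
  has_type Gamma M A.
Proof.
  induction 1; intros r M0 Gamma0 E HD; eauto using has_type;
    destruct M0; simpl in E; try discriminate; injection E; intros; subst.
  - rewrite HD. apply ht_var.
  - apply ht_abs. eapply IHhas_type; [reflexivity|].
    intros [|n]; [reflexivity|apply HD].
  - eauto using has_type.
  - eauto using has_type.
Qed.

(** The hypothesis is weaker than [subtype (Delta n) (Gamma n)]: without a
    subtyping rule introducing intersections on the right, [A <= Inter A A] is
    not derivable. *)
Lemma has_type_narrow Gamma M A :
  has_type Gamma M A ->
  forall Delta, (forall n, has_type Delta (Var n) (Gamma n)) ->
  has_type Delta M A.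
Proof.
  induction 1; intros Delta HD; eauto using has_type.
  apply ht_abs, IHhas_type. intros [|n]; [apply (ht_var (scons A Delta))|].
  apply (has_type_rename Delta (Var n) (Gamma n)) with (r := S); auto.
Qed.

Lemma has_type_var Gamma n A :
  has_type Gamma (Var n) A ->
  forall Delta m, Delta m = Gamma n -> has_type Delta (Var m) A.
Proof.
  intros H. remember (Var n) as P eqn:E.
  induction H; intros Delta m HD; try discriminate; eauto using has_type.
  injection E; intros ->. rewrite <- HD. apply ht_var.
Qed.

Definition inter_ctx (Gamma Delta : nat -> type) (n : nat) : type :=
  Inter (Gamma n) (Delta n).

Lemma has_type_inter_l Gamma Delta M A :
  has_type Gamma M A -> has_type (inter_ctx Gamma Delta) M A.
Proof.
  intros H. apply has_type_narrow with (1 := H). intros n.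
  eapply ht_sub; [apply ht_var|apply st_inter_l].
Qed.

Lemma has_type_inter_r Gamma Delta M A :
  has_type Delta M A -> has_type (inter_ctx Gamma Delta) M A.
Proof.
  intros H. apply has_type_narrow with (1 := H). intros n.
  eapply ht_sub; [apply ht_var|apply st_inter_r].
Qed.

(** * Inversion of applications and subject expansion *)

Lemma has_type_app_inv Gamma M N B :
  has_type Gamma (App M N) B ->
  exists A, has_type Gamma M (Arrow A B) /\ has_type Gamma N A.
Proof.
  intros H. remember (App M N) as P eqn:E.
  induction H as [| |Gamma M' N' A B HM _ HN _|Gamma P A B _ IH1 _ IH2| |Gamma P A A' _ IH Hs];
    try discriminate.
  - injection E; intros; subst. eauto.
  - destruct (IH1 E) as [A1 [HM1 HN1]]. destruct (IH2 E) as [A2 [HM2 HN2]].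
    (* By contravariance both arrows can be given the domain [Inter A1 A2]; [st_arrow_inter] then
       merges them into one. *)
    exists (Inter A1 A2). split; [|apply ht_int; assumption].
    eapply ht_sub; [apply ht_int|apply st_arrow_inter].
    + eapply ht_sub; [exact HM1|].
      apply st_arrow; [apply st_inter_l|apply st_refl].
    + eapply ht_sub; [exact HM2|].
      apply st_arrow; [apply st_inter_r|apply st_refl].
  - destruct (IH E) as [A1 [HM HN]]. exists A1. split; [|exact HN].
    eapply ht_sub; [exact HM|]. apply st_arrow; [apply st_refl|exact Hs].
Qed.

(** [D] provides types for the variables that do not occur in [M]. *)
Lemma has_type_subst_inv Gamma P B :
  has_type Gamma P B ->
  forall M s D, P = subst s M -> (forall n, has_type Gamma (s n) (D n)) ->
  exists Delta, has_type Delta M B /\ forall n, has_type Gamma (s n) (Delta n).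
Proof.
  assert (Hvar : forall Gamma B n s D,
    has_type Gamma (s n) B -> (forall m, has_type Gamma (s m) (D m)) ->
    exists Delta, has_type Delta (Var n) B /\
      forall m, has_type Gamma (s m) (Delta m)).
  { clear. intros Gamma B n s D HB HD.
    set (Delta m := if Nat.eq_dec m n then B else D m).
    exists Delta. split.
    - replace B with (Delta n); [apply ht_var|].
      unfold Delta. destruct (Nat.eq_dec n n); congruence.
    - intros m. unfold Delta. destruct (Nat.eq_dec m n); subst; auto. }
  assert (Hmerge : forall Gamma s Delta1 Delta2,
    (forall n, has_type Gamma (s n) (Delta1 n)) ->
    (forall n, has_type Gamma (s n) (Delta2 n)) ->
    forall n, has_type Gamma (s n) (inter_ctx Delta1 Delta2 n)).
  { intros. apply ht_int; auto. }
  induction 1 as [Gamma n|Gamma P A B HP IH|Gamma P Q A B HP IHP HQ IHQ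
    |Gamma P A B HA IHA HB IHB|Gamma P Q A HP IHP HQ IHQ|Gamma P A A' HP IH Hs];
    intros M s D E HD.
  - destruct M; try discriminate E. simpl in E.
    apply Hvar with D; [rewrite <- E; apply ht_var|exact HD].
  - destruct M; try discriminate E; simpl in E.
    { apply Hvar with D; [rewrite <- E; apply ht_abs, HP|exact HD]. }
    injection E; intros ->.
    destruct (IH _ _ (scons A D) eq_refl) as [Delta [HM HDelta]].
    { intros [|n]; [apply (ht_var (scons A Gamma))|].
      apply has_type_rename with (1 := HD n). reflexivity. }
    exists (fun n => Delta (S n)). split.
    (* [Delta 0] may differ from [A], but [HDelta 0] derives it for a variable of type [A], so
       narrowing restores [A]. *)
    + apply ht_abs. apply has_type_narrow with (1 := HM). intros [|n].
      * apply has_type_var with (1 := HDelta 0). reflexivity.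
      * apply (ht_var (scons A (fun n => Delta (S n))) (S n)).
    + intros n. eapply has_type_rename_inv.
      * apply (HDelta (S n)).
      * reflexivity.
      * reflexivity.
  - destruct M; try discriminate E; simpl in E.
    { apply Hvar with D; [rewrite <- E; eauto using has_type|exact HD]. }
    injection E; intros -> ->.
    destruct (IHP _ _ D eq_refl HD) as [D1 [H1 HD1]].
    destruct (IHQ _ _ D eq_refl HD) as [D2 [H2 HD2]].
    exists (inter_ctx D1 D2). split; [|auto].
    apply ht_app with A; auto using has_type_inter_l, has_type_inter_r.
  - destruct (IHA _ _ D E HD) as [D1 [H1 HD1]].
    destruct (IHB _ _ D E HD) as [D2 [H2 HD2]].
    exists (inter_ctx D1 D2). split; [|auto].
    apply ht_int; auto using has_type_inter_l, has_type_inter_r.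
  - destruct M; try discriminate E; simpl in E.
    { apply Hvar with D; [rewrite <- E; eauto using has_type|exact HD]. }
    injection E; intros -> ->.
    destruct (IHP _ _ D eq_refl HD) as [D1 [H1 HD1]].
    destruct (IHQ _ _ D eq_refl HD) as [D2 [H2 HD2]].
    exists (inter_ctx D1 D2). split; [|auto].
    apply ht_plus; auto using has_type_inter_l, has_type_inter_r.
  - destruct (IH _ _ D E HD) as [D1 [H1 HD1]].
    exists D1. split; [|exact HD1]. eauto using has_type.
Qed.

(** The type [A] of [N] covers the case where the substitution erases [N]; otherwise the types that
    the copies of [N] receive are collected in [Delta 0]. *)
Lemma has_type_beta_exp Gamma M N A B :
  has_type Gamma (subst1 N M) B -> has_type Gamma N A ->
  has_type Gamma (App (Lam M) N) B.
Proof.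
  intros HB HN.
  destruct (has_type_subst_inv _ _ _ HB M _ (scons A Gamma) eq_refl)
    as [Delta [HM HDelta]].
  { intros [|n]; [exact HN|apply (ht_var Gamma)]. }
  apply ht_app with (Delta 0); [|apply (HDelta 0)].
  apply ht_abs. apply has_type_narrow with (1 := HM). intros [|n].
  - apply (ht_var (scons (Delta 0) Gamma)).
  - apply (has_type_var Gamma n _ (HDelta (S n))). reflexivity.
Qed.

(** * Spines and typability with arbitrarily many arrows *)

Definition apps (M : term) (Ps : list term) : term := fold_left App Ps M.

Lemma apps_snoc M Ps P : apps M (Ps ++ [P]) = App (apps M Ps) P.
Proof. apply fold_left_app. Qed.

Lemma has_type_apps_mono Gamma H H' Ps :
  (forall B, has_type Gamma H B -> has_type Gamma H' B) ->
  forall B, has_type Gamma (apps H Ps) B -> has_type Gamma (apps H' Ps) B.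
Proof.
  intros HH. induction Ps as [|P Ps IH] using rev_ind; [exact HH|].
  intros B. rewrite !apps_snoc. intros HB.
  apply has_type_app_inv in HB as [A [HA HP]]. eauto using has_type.
Qed.

(** [has_type] has no rule for the identities, so distribution over a spine is proved here. The two
    sides may type an argument differently; the sum takes the intersection as its domain. *)
Lemma has_type_apps_plus Gamma M N Ps B :
  has_type Gamma (apps M Ps) B -> has_type Gamma (apps N Ps) B ->
  has_type Gamma (apps (Plus M N) Ps) B.
Proof.
  revert B. induction Ps as [|P Ps IH] using rev_ind; intros B.
  { apply ht_plus. }
  rewrite !apps_snoc. intros HM HN.
  apply has_type_app_inv in HM as [A1 [HM HP1]].
  apply has_type_app_inv in HN as [A2 [HN HP2]].
  apply ht_app with (Inter A1 A2); [|apply ht_int; assumption].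
  apply IH.
  - eapply ht_sub; [exact HM|].
    apply st_arrow; [apply st_inter_l|apply st_refl].
  - eapply ht_sub; [exact HN|].
    apply st_arrow; [apply st_inter_r|apply st_refl].
Qed.

Definition arrows (Ts : list type) (A : type) : type := fold_right Arrow A Ts.

Fixpoint inter_list (Ts Us : list type) : list type :=
  match Ts, Us with
  | T :: Ts, U :: Us => Inter T U :: inter_list Ts Us
  | _, _ => []
  end.

Lemma length_inter_list Ts Us :
  length Ts = length Us -> length (inter_list Ts Us) = length Ts.
Proof.
  revert Us. induction Ts as [|T Ts IH]; intros [|U Us]; simpl; auto.
Qed.

Lemma arrows_inter Ts Us A :
  length Ts = length Us ->
  subtype (arrows Ts A) (arrows (inter_list Ts Us) A) /\
  subtype (arrows Us A) (arrows (inter_list Ts Us) A).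
Proof.
  revert Us. induction Ts as [|T Ts IH]; intros [|U Us] E; try discriminate E.
  - split; apply st_refl.
  - injection E as E. destruct (IH Us E) as [H1 H2].
    split; apply st_arrow;
      [apply st_inter_l|exact H1|apply st_inter_r|exact H2].
Qed.

(** A single [n] would not do, since two summands must agree on one; bounds from which every [n]
    works always have a common upper bound. Fixing the final [TVar 0] makes the targets agree
    too. *)
Definition typable (M : term) : Prop :=
  exists n0, forall n, n0 <= n ->
  exists Gamma Ts, length Ts = n /\ has_type Gamma M (arrows Ts (TVar 0)).

Lemma typable_has_type M : typable M -> exists Gamma A, has_type Gamma M A.
Proof.
  intros [n0 H]. destruct (H n0 (le_n _)) as [Gamma [Ts [_ HM]]]. eauto.
Qed.

Lemma has_type_list Ps :
  Forall typable Ps -> exists Gamma Bs, Forall2 (has_type Gamma) Ps Bs.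
Proof.
  induction 1 as [|P Ps HP _ [Gamma [Bs IH]]].
  - exists (fun _ => TVar 0), []. constructor.
  - apply typable_has_type in HP as [Delta [A HP]].
    exists (inter_ctx Delta Gamma), (A :: Bs). constructor.
    + apply has_type_inter_l, HP.
    + apply Forall2_impl with (2 := IH). intros; apply has_type_inter_r; assumption.
Qed.

Lemma has_type_apps Gamma Ps Bs :
  Forall2 (has_type Gamma) Ps Bs ->
  forall M A, has_type Gamma M (arrows Bs A) -> has_type Gamma (apps M Ps) A.
Proof.
  induction 1 as [|P B Ps Bs HP _ IH]; intros M A HM; [exact HM|].
  apply IH. eapply ht_app; [exact HM|exact HP].
Qed.

Lemma typable_var n Ps : Forall typable Ps -> typable (apps (Var n) Ps).
Proof.
  intros HPs. apply has_type_list in HPs as [Gamma [Bs HPs]].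
  (* The result type of a head variable is free, so every [m] is reached. The second component of
     the context types the head, the first one the arguments. *)
  exists 0. intros m _. set (Ts := repeat (TVar 0) m).
  exists (inter_ctx Gamma (fun _ => arrows Bs (arrows Ts (TVar 0)))), Ts.
  split; [apply repeat_length|].
  apply has_type_apps with Bs.
  - apply Forall2_impl with (2 := HPs). intros; apply has_type_inter_l; assumption.
  - apply has_type_inter_r. apply ht_var with (Gamma := fun _ => _).
Qed.

Lemma typable_lam M : typable M -> typable (Lam M).
Proof.
  (* The abstraction contributes one arrow, with domain [Gamma 0]. *)
  intros [n0 HM]. exists (S n0). intros [|n] Hn; [lia|].
  destruct (HM n) as [Gamma [Ts [E HT]]]; [lia|].
  exists (fun k => Gamma (S k)), (Gamma 0 :: Ts). split; [simpl; congruence|].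
  apply ht_abs. apply has_type_narrow with (1 := HT).
  intros [|k]; apply (has_type_var _ _ _ (ht_var Gamma _)); reflexivity.
Qed.

Lemma typable_plus M N Ps :
  typable (apps M Ps) -> typable (apps N Ps) -> typable (apps (Plus M N) Ps).
Proof.
  intros [m HM] [n HN]. exists (m + n). intros k Hk.
  destruct (HM k) as [Gamma [Ts [ET HT]]]; [lia|].
  destruct (HN k) as [Delta [Us [EU HU]]]; [lia|].
  assert (E : length Ts = length Us) by congruence.
  destruct (arrows_inter Ts Us (TVar 0) E) as [S1 S2].
  exists (inter_ctx Gamma Delta), (inter_list Ts Us).
  split; [rewrite length_inter_list; congruence|].
  apply has_type_apps_plus.
  - apply has_type_inter_l. eauto using has_type.
  - apply has_type_inter_r. eauto using has_type.
Qed.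

Lemma typable_beta_exp M N Ps :
  typable (apps (subst1 N M) Ps) -> typable N ->
  typable (apps (App (Lam M) N) Ps).
Proof.
  intros [n0 HM] HN. apply typable_has_type in HN as [Delta [A HN]].
  exists n0. intros n Hn. destruct (HM n Hn) as [Gamma [Ts [E HT]]].
  exists (inter_ctx Gamma Delta), Ts. split; [exact E|].
  apply has_type_apps_mono with (subst1 N M).
  - intros B HB. apply has_type_beta_exp with A; [exact HB|].
    apply has_type_inter_r, HN.
  - apply has_type_inter_l, HT.
Qed.

(** * Size and spine form *)

Fixpoint size (M : term) : nat :=
  match M with
  | Var _ => 1
  | Lam M => S (size M)
  | App M N | Plus M N => S (size M + size N)
  end.

Lemma size_apps M Ps : size (apps M Ps) = size M + list_sum (map S (map size Ps)).
Proof.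
  revert M. induction Ps as [|P Ps IH]; intros M; simpl; [lia|].
  rewrite IH. simpl. lia.
Qed.

Lemma size_arg M P Ps : In P Ps -> size P < size (apps M Ps).
Proof.
  rewrite size_apps. induction Ps as [|Q Ps IH]; simpl; [tauto|].
  intros [->|HP]; [lia|]. specialize (IH HP). lia.
Qed.

Lemma spine M :
  exists H Ps, M = apps H Ps /\ match H with App _ _ => False | _ => True end.
Proof.
  induction M as [n|M _|M [H [Ps [-> HH]]] N _|M _ N _].
  - exists (Var n), []. auto.
  - exists (Lam M), []. auto.
  - exists H, (Ps ++ [N]). rewrite apps_snoc. auto.
  - exists (Plus M N), []. auto.
Qed.

(* Term contexts and the main induction *)
#[local] Hint Constructors term_eq beta_raw : core.

(** Stands for a term with a hole: it carries equations and steps of a part over to the whole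
    term. *)
Definition monotone (C : term -> term) : Prop :=
  (forall M N, term_eq M N -> term_eq (C M) (C N)) /\
  (forall M N, beta M N -> beta (C M) (C N)).

Lemma monotone_comp C D :
  monotone C -> monotone D -> monotone (fun M => C (D M)).
Proof. intros [C1 C2] [D1 D2]. split; auto. Qed.

Lemma monotone_raw (C : term -> term) :
  (forall M N, term_eq M N -> term_eq (C M) (C N)) ->
  (forall M N, beta_raw M N -> beta_raw (C M) (C N)) -> monotone C.
Proof.
  intros HE HB. split; [exact HE|].
  intros M N [M' [N' [H1 [H2 H3]]]]. exists (C M'), (C N'). auto.
Qed.

Lemma monotone_lam : monotone Lam.
Proof. apply monotone_raw; [apply teq_lam|apply beta_lam]. Qed.

Lemma monotone_app_l N : monotone (fun M => App M N).
Proof. apply monotone_raw; auto. Qed.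

Lemma monotone_app_r M : monotone (App M).
Proof. apply monotone_raw; auto. Qed.

Lemma monotone_plus_l N : monotone (fun M => Plus M N).
Proof. apply monotone_raw; auto. Qed.

Lemma monotone_plus_r M : monotone (Plus M).
Proof. apply monotone_raw; auto. Qed.

Lemma monotone_apps Ps : monotone (fun M => apps M Ps).
Proof.
  induction Ps as [|P Ps IH]; [apply monotone_raw; auto|].
  apply (monotone_comp _ _ IH (monotone_app_l P)).
Qed.

Lemma term_eq_apps_plus M N Ps :
  term_eq (apps (Plus M N) Ps) (Plus (apps M Ps) (apps N Ps)).
Proof.
  induction Ps as [|P Ps IH] using rev_ind; [apply teq_refl|].
  rewrite !apps_snoc. eapply teq_trans; [|apply teq_app_plus].
  apply teq_app; [exact IH|apply teq_refl].
Qed.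

(** The outer induction is on the whole term [M], so the inner one may pass to
    any part [N] of [M], up to [term_eq], as long as it gets smaller. *)
Lemma acc_typable M :
  Acc (fun N M => beta M N) M ->
  forall C N, monotone C -> term_eq M (C N) -> typable N.
Proof.
  induction 1 as [M _ IHM].
  intros C N. remember (size N) as k eqn:Ek. revert C N Ek.
  induction k as [k IHk] using lt_wf_ind. intros C N -> HC HM.
  assert (IHN : forall D Q, size Q < size N -> monotone D ->
    term_eq N (D Q) -> typable Q).
  { intros D Q Hs HD HQ. apply (IHk (size Q) Hs (fun R => C (D R))); auto.
    - apply monotone_comp; assumption.
    - eapply teq_trans; [exact HM|]. apply HC, HQ. }
  (* A step from [N] to [Q] is a step from [M] to [C Q], so the outer induction applies. *)
  assert (IHbeta : forall Q, beta N Q -> typable Q).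
  { intros Q HQ. apply (IHM (C Q)) with C; [|exact HC|apply teq_refl].
    destruct (proj2 HC _ _ HQ) as [M' [Q' [H1 H2]]].
    exists M', Q'. eauto. }
  clear IHM IHk HC HM C.
  destruct (spine N) as [H [Ps [-> HH]]].
  assert (Hargs : forall P, In P Ps -> typable P).
  { intros P HP. pose proof (size_arg H P Ps HP) as Hs.
    apply in_split in HP as [Ps1 [Ps2 ->]].
    apply (IHN (fun Q => apps (App (apps H Ps1) Q) Ps2)); [exact Hs| |].
    - apply (monotone_comp _ _ (monotone_apps Ps2) (monotone_app_r _)).
    - unfold apps. rewrite fold_left_app. apply teq_refl. }
  destruct H as [n|L|? ?|L R]; [| |contradiction|].
  - apply typable_var, Forall_forall, Hargs.
  - destruct Ps as [|P Ps].
    + apply typable_lam. apply (IHN Lam); simpl; auto.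
      apply monotone_lam.
    (* The contracted spine is a reduct; the argument [P], which it may have lost, is typable as a
       smaller part. *)
    + apply typable_beta_exp; [|apply Hargs; left; reflexivity].
      apply IHbeta. apply (proj2 (monotone_apps Ps)).
      exists (App (Lam L) P), (subst1 P L). eauto.
  (* Distribution copies [Ps], but each summand, taken alone, is smaller than the original spine. *)
  - apply typable_plus.
    + apply (IHN (fun Q => Plus Q (apps R Ps))).
      * rewrite !size_apps. simpl. lia.
      * apply monotone_plus_l.
      * apply term_eq_apps_plus.
    + apply (IHN (Plus (apps L Ps))).
      * rewrite !size_apps. simpl. lia.
      * apply monotone_plus_r.
      * apply term_eq_apps_plus.
Qed.

(** * From strong normalization to typing in a finite context *)

Lemma strongly_normalizable_acc M :
  strongly_normalizable M -> Acc (fun N M => beta M N) M.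
Proof.
  intros HM. apply NNPP. intros HA. apply HM.
  set (R := fun N M => beta M N) in *.
  (* Classically, a non-accessible term has a non-accessible reduct; choosing one again and again
     yields an infinite reduction. *)
  assert (Hstep : forall x : {N | ~ Acc R N},
    exists y : {N | ~ Acc R N}, beta (proj1_sig x) (proj1_sig y)).
  { intros [N HN]. simpl. apply NNPP. intros Hno. apply HN. constructor.
    intros Q HQ. apply NNPP. intros HQA. apply Hno. exists (exist _ Q HQA).
    exact HQ. }
  set (next x := proj1_sig (constructive_indefinite_description _ (Hstep x))).
  exists (fun n => proj1_sig (Nat.iter n next (exist _ M HA))).
  split; [reflexivity|]. intros n.
  exact (proj2_sig (constructive_indefinite_description _ (Hstep _))).
Qed.

Theorem theorem3 :
  forall M : term,
    strongly_normalizable M ->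
    exists (Gamma : context) (A : type), typing Gamma M A.
Proof.
  intros M HM. apply strongly_normalizable_acc in HM.
  assert (HT : typable M).
  { apply acc_typable with (1 := HM) (C := fun N => N); [|apply teq_refl].
    apply monotone_raw; auto. }
  apply typable_has_type in HT as [Gamma [A HT]].
  apply has_type_typing in HT as [k Hk].
  (* The total context is cut to its first [k] entries. *)
  exists (map Gamma (seq 0 k)), A. apply Hk. intros n Hn.
  rewrite nth_error_map, nth_error_seq.
  apply Nat.ltb_lt in Hn. rewrite Hn. reflexivity.
Qed.
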